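(* Let $d\ge 2$ and $\sigma>\frac12$ be such that $s_c:=\frac d2-\frac1\sigma=\frac12$. Then for any $a>0$ there exists a global (that is, defined for all $\xi\ge 0$) nontrivial (that is, not identically zero) solution $Q:[0,\infty)\to\mathbb{C}$ of $$\Delta_\xi Q-Q+ia\left(\frac{Q}{\sigma}+\xi Q_\xi\right)+|Q|^{2\sigma}Q=0\quad(\xi>0),\qquad Q_\xi(0)=0,\quad Q(0)\in\mathbb{R},\quad \lim_{\xi\to\infty}Q(\xi)=0,$$ such that $Q(\xi)=\xi^{-1/\sigma}R(\xi)$ for $\xi>0$, where $R$ is a bounded function on $(0,\infty)$.
   Context: Here $\Delta_\xi:=\partial_{\xi\xi}+\frac{d-1}{\xi}\partial_\xi$ is the radial Laplacian in dimension $d$, where $d$ enters the equation only as a real parameter; $Q_\xi$ denotes the derivative of $Q$ in the radial variable $\xi\ge0$, and $i$ is the imaginary unit. Solutions are classical (twice continuously differentiable) solutions of the differential equation. *)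

(* Defs.v *)
From Stdlib Require Import Reals.
From Coquelicot Require Import Coquelicot.

Open Scope R_scope.

(* A function on [0,oo) is represented by a total function on R of which only
   the restriction to [ray] is ever used: derivatives and continuity are taken
   relatively to [ray], hence one-sidedly at 0. *)
Definition ray (x : R) : Prop := 0 <= x.

Definition is_derive_on_ray (f df : R -> C) : Prop :=
  forall x : R, 0 <= x ->
    filterdiff (U := R_NormedModule) (V := C_R_NormedModule)
      f (within ray (locally x)) (fun y : R => scal y (df x)).

Definition is_C2_on_ray (f f1 f2 : R -> C) : Prop :=
  is_derive_on_ray f f1 /\ is_derive_on_ray f1 f2 /\
  continuous_on (T := R_UniformSpace) (U := C_UniformSpace) ray f2.

(* x ^ p for x >= 0 and p > 0. [Rpower 0 p] evaluates to 1 in the standard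
   library, so the value 0 ^ p = 0 is set by hand. *)
Definition nnpow (x p : R) : R :=
  if Req_dec_T x 0 then 0 else Rpower x p.

(* The radial Laplacian, in terms of the values at xi of the first and second
   derivatives. *)
Definition radial_laplacian (d xi : R) (q1 q2 : C) : C :=
  (q2 + RtoC ((d - 1) / xi) * q1)%C.

Definition profile_equation_at (d sigma a xi : R) (q q1 q2 : C) : Prop :=
  (radial_laplacian d xi q1 q2 - q
   + Ci * RtoC a * (q / RtoC sigma + RtoC xi * q1)
   + RtoC (nnpow (Cmod q) (2 * sigma)) * q)%C = RtoC 0.

(* Q is a classical solution on [0,oo) of the boundary value problem; the
   derivatives Q1, Q2 of Q on [0,oo) are unique. *)
Definition global_profile (d sigma a : R) (Q : R -> C) : Prop :=
  exists Q1 Q2 : R -> C,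
    is_C2_on_ray Q Q1 Q2 /\
    (forall xi : R, 0 < xi ->
       profile_equation_at d sigma a xi (Q xi) (Q1 xi) (Q2 xi)) /\
    Q1 0 = RtoC 0 /\
    Im (Q 0) = 0 /\
    filterlim Q (Rbar_locally p_infty)
      (locally (T := C_UniformSpace) (RtoC 0)).

(* Main.v *)
Require Import Defs.
From Stdlib Require Import Reals Lra.
From Coquelicot Require Import Coquelicot.
Open Scope R_scope.

(** Write [b = 1 / sigma], so that [d - 1 = 2 b]. Multiplying the equation by
    the integrating factor [xi^(d-1) e^(i a xi^2/2)] turns it, together with
    [Q(0) = eps] and [Q'(0) = 0], into the Volterra equation
    [Q = eps + int damp (N(s, Q))], where [damp f] is the solution of
    [y' + ((d-1)/xi + i a xi) y = f] regular at the origin and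
    [N(s, q) = (1 - i a b - |q|^(2 sigma)) q]. The kernel of [damp] has modulus
    at most 1, so only the nonlinearity could obstruct global existence.

    The nonlinearity is therefore truncated: [|q|] is replaced by
    [min(|q|, cutoff b s)] inside the power, with [cutoff b s = max(1,s)^(-b)],
    the decay that the solution should have. The truncated [N] is globally
    Lipschitz, since [2 sigma >= 1], and Picard iteration in the weight
    [exp(2 L s)] gives a global solution with [|Q| <= 2 eps exp(2 L s)]
    ([damped_ivp]), twice differentiable up to the origin ([damp_is_C2]).

    It remains to see that the truncation is inactive when [eps] is small. Up
    to a fixed [X0] the exponential bound suffices. Beyond, put [R = xi^b Q].
    The criticality [s_c = 1/2] cancels the zeroth-order part of the drift:
    [R'' + i a xi R' - (1 + g) R = 0] with [g = (b^2-b)/xi^2 - V], and the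
    truncation makes the potential satisfy [0 <= V <= xi^(-2)]. The quantity
    [F = |R'|^2 + |R|^2 + (4/(a xi)) Im(conj(R) R')] combines the energy
    [|R'|^2 - |R|^2] with twice the normalized mass
    [|R|^2 + (2/(a xi)) Im(conj(R) R')]. It is comparable with
    [|R|^2 + |R'|^2] for [xi >= 4/a], and the terms of [F'] that are not
    [O(xi^(-2)) F] cancel. As [xi^(-2)] is integrable, [F] stays below a
    constant times its value at [X0] ([oscillator_energy_bound]), which is
    [O(eps^2)]. Hence [|R| <= 1] for small [eps]: the solution solves the
    original equation and [|Q| <= xi^(-b)], which gives both the decay and the
    bound on [R]. *)

(** * Calculus of complex-valued functions of a real variable *)

Notation cderive := (@is_derive R_AbsRing C_R_NormedModule).
Notation ccont := (@continuous R_UniformSpace C_UniformSpace).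
Notation CInt := (@RInt C_R_CompleteNormedModule).

Lemma is_derive_C_comp (f : R -> C) (x : R) (l : C) :
  cderive f x l <->
  is_derive (fun y => Re (f y)) x (Re l) /\ is_derive (fun y => Im (f y)) x (Im l).
Proof.
split.
- intros H; split.
  + apply (filterdiff_ext_lin (fun y => Re (f y)) (fun y : R => Re (scal y l : C_R_NormedModule))).
    2: now intros y; destruct l.
    apply (filterdiff_comp' f (fun z : C_R_NormedModule => fst z) x _ (fun z : C_R_NormedModule => fst z)).
    exact H. apply filterdiff_linear, is_linear_fst.
  + apply (filterdiff_ext_lin (fun y => Im (f y)) (fun y : R => Im (scal y l : C_R_NormedModule))).
    2: now intros y; destruct l.
    apply (filterdiff_comp' f (fun z : C_R_NormedModule => snd z) x _ (fun z : C_R_NormedModule => snd z)).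
    exact H. apply filterdiff_linear, is_linear_snd.
- intros [H1 H2].
  apply (is_derive_ext (V := C_R_NormedModule)
    (fun y => plus (scal (Re (f y)) ((1, 0) : C_R_NormedModule))
                   (scal (Im (f y)) ((0, 1) : C_R_NormedModule)))).
  { intros t. destruct (f t) as [u v].
    cbv -[Rplus Rmult]. f_equal; ring. }
  replace l with (plus (scal (Re l) ((1, 0) : C_R_NormedModule))
                   (scal (Im l) ((0, 1) : C_R_NormedModule))).
  2: { destruct l as [u v]. cbv -[Rplus Rmult]. f_equal; ring. }
  apply @is_derive_plus; apply @is_derive_scal_l; assumption.
Qed.

Lemma continuous_C_comp (f : R -> C) (x : R) :
  ccont f x <->
  continuous (fun y => Re (f y)) x /\ continuous (fun y => Im (f y)) x.
Proof.
split.
- intros H; split.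
  + apply (continuous_comp f fst); [exact H | apply continuous_fst].
  + apply (continuous_comp f snd); [exact H | apply continuous_snd].
- intros [H1 H2].
  apply (continuous_ext (fun y => (Re (f y), Im (f y)))).
  { intros t; now destruct (f t). }
  intros P [e He]. specialize (H1 _ (locally_ball _ e)). specialize (H2 _ (locally_ball _ e)).
  unfold filtermap in *. generalize (filter_and _ _ H1 H2). apply filter_imp.
  intros t [K1 K2]. apply He. split; assumption.
Qed.

Lemma is_derive_Cmult (f g : R -> C) (x : R) (lf lg : C) :
  cderive f x lf -> cderive g x lg ->
  cderive (fun y => f y * g y)%C x (lf * g x + f x * lg)%C.
Proof.
intros Hf Hg. apply is_derive_C_comp in Hf; apply is_derive_C_comp in Hg.
destruct Hf as [F1 F2], Hg as [G1 G2].
apply is_derive_C_comp; split; cbn -[Rplus Rmult].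
- change (is_derive (fun y => minus (mult (Re (f y)) (Re (g y))) (mult (Im (f y)) (Im (g y)))) x
   (Re lf * Re (g x) - Im lf * Im (g x) + (Re (f x) * Re lg - Im (f x) * Im lg))).
  replace (Re lf * Re (g x) - Im lf * Im (g x) + (Re (f x) * Re lg - Im (f x) * Im lg))
   with (minus (plus (mult (Re lf) (Re (g x))) (mult (Re (f x)) (Re lg)))
               (plus (mult (Im lf) (Im (g x))) (mult (Im (f x)) (Im lg)))).
  apply @is_derive_minus; apply @is_derive_mult; auto; intros; apply Rmult_comm.
  cbv -[Rplus Rmult Ropp]; ring.
- change (is_derive (fun y => plus (mult (Re (f y)) (Im (g y))) (mult (Im (f y)) (Re (g y)))) x
   (Re lf * Im (g x) + Im lf * Re (g x) + (Re (f x) * Im lg + Im (f x) * Re lg))).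
  replace (Re lf * Im (g x) + Im lf * Re (g x) + (Re (f x) * Im lg + Im (f x) * Re lg))
   with (plus (plus (mult (Re lf) (Im (g x))) (mult (Re (f x)) (Im lg)))
               (plus (mult (Im lf) (Re (g x))) (mult (Im (f x)) (Re lg)))).
  apply @is_derive_plus; apply @is_derive_mult; auto; intros; apply Rmult_comm.
  cbv -[Rplus Rmult Ropp]; ring.
Qed.

Lemma is_derive_RtoC (f : R -> R) (x l : R) :
  is_derive f x l -> cderive (fun y => RtoC (f y)) x (RtoC l).
Proof.
intros H. apply is_derive_C_comp; split. exact H.
apply (is_derive_const (K := R_AbsRing) (V := R_NormedModule) 0).
Qed.

Lemma continuous_Cmult (f g : R -> C) (x : R) :
  ccont f x -> ccont g x -> ccont (fun y => f y * g y)%C x.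
Proof.
intros Hf Hg. apply continuous_C_comp in Hf; apply continuous_C_comp in Hg.
destruct Hf as [F1 F2], Hg as [G1 G2].
apply continuous_C_comp; split.
- apply (continuous_minus (V := R_NormedModule)); now apply (continuous_mult (K := R_AbsRing)).
- apply (continuous_plus (V := R_NormedModule)); now apply (continuous_mult (K := R_AbsRing)).
Qed.

Lemma continuous_RtoC (f : R -> R) (x : R) :
  continuous f x -> ccont (fun y => RtoC (f y)) x.
Proof.
intros H; apply continuous_C_comp; split; [exact H | apply continuous_const].
Qed.

Lemma continuous_Cmod (f : R -> C) (x : R) :
  ccont f x -> continuous (fun y => Cmod (f y)) x.
Proof.
intros H. apply (continuous_ext (fun y => norm (f y : C_R_NormedModule))).
{ intros t; symmetry; apply Cmod_norm. }
apply (continuous_comp (f : R -> C_R_NormedModule) norm); [exact H | apply filterlim_norm].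
Qed.

Lemma CInt_correct (f : R -> C) (a b : R) :
  (forall s, ccont f s) -> is_RInt (V := C_R_NormedModule) f a b (CInt f a b).
Proof.
intros H. apply (RInt_correct (V := C_R_CompleteNormedModule)).
apply (ex_RInt_continuous (V := C_R_CompleteNormedModule)). intros z _; apply H.
Qed.

Lemma is_derive_CInt (f : R -> C) (a x : R) :
  (forall s, ccont f s) -> cderive (fun y => CInt f a y) x (f x).
Proof.
intros H. apply (is_derive_RInt (V := C_R_NormedModule) f _ a x).
- apply filter_forall. intros y; now apply CInt_correct.
- apply H.
Qed.

Lemma Cmod_CInt_le (f : R -> C) (g : R -> R) (a b : R) :
  (forall s, ccont f s) -> (forall s, continuous g s) -> a <= b ->
  (forall s, a <= s <= b -> Cmod (f s) <= g s) ->
  Cmod (CInt f a b) <= RInt g a b.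
Proof.
intros Hf Hg Hab H. rewrite Cmod_norm.
apply (norm_RInt_le (V := C_R_NormedModule) f g a b); auto.
- intros s Hs. rewrite <- Cmod_norm. now apply H.
- now apply CInt_correct.
- apply (RInt_correct (V := R_CompleteNormedModule)).
  apply (ex_RInt_continuous (V := R_CompleteNormedModule)). intros z _; apply Hg.
Qed.

Lemma CInt_minus (f g : R -> C) (a b : R) :
  (forall s, ccont f s) -> (forall s, ccont g s) ->
  CInt (fun s => f s - g s)%C a b = (CInt f a b - CInt g a b)%C.
Proof.
intros Hf Hg.
apply (RInt_minus (V := C_R_CompleteNormedModule) f g);
 apply (ex_RInt_continuous (V := C_R_CompleteNormedModule)); intros z _; auto.
Qed.

Lemma cderive_ccont (f : R -> C) (x : R) (l : C) : cderive f x l -> ccont f x.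
Proof.
intros H. apply (ex_derive_continuous (V := C_R_NormedModule)). now exists l.
Qed.
(** * Powers *)

Lemma exp_mono (x y : R) : x <= y -> exp x <= exp y.
Proof.
intros [H | ->]; [apply Rlt_le, exp_increasing, H | apply Rle_refl].
Qed.

(** Extending by [0] to the negative axis makes the weight of the equation a
    continuous function on the whole line, so that integrals and derivatives
    need no one-sided versions. *)
Definition powp (p x : R) : R := nnpow (Rmax 0 x) p.

Lemma powp_nonpos (p x : R) : x <= 0 -> powp p x = 0.
Proof.
intros H. unfold powp, nnpow. rewrite Rmax_left by lra. now destruct (Req_dec_T 0 0).
Qed.

Lemma powp_pos (p x : R) : 0 < x -> powp p x = Rpower x p.
Proof.
intros H. unfold powp, nnpow. rewrite Rmax_right by lra. destruct (Req_dec_T x 0); [lra | easy].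
Qed.

Lemma powp_nnpow (p x : R) : 0 <= x -> powp p x = nnpow x p.
Proof. intros H. unfold powp. now rewrite Rmax_right. Qed.

Lemma powp_gt0 (p x : R) : 0 < x -> 0 < powp p x.
Proof. intros H; rewrite powp_pos by easy. apply exp_pos. Qed.

Lemma powp_ge0 (p x : R) : 0 <= powp p x.
Proof.
destruct (Rle_or_lt x 0) as [H | H].
- rewrite powp_nonpos; lra.
- now apply Rlt_le, powp_gt0.
Qed.

Lemma powp_incr (p x y : R) : 0 <= p -> x <= y -> powp p x <= powp p y.
Proof.
intros Hp Hxy. destruct (Rle_or_lt x 0) as [H | H].
- rewrite (powp_nonpos p x) by easy. apply powp_ge0.
- rewrite !powp_pos by lra. apply Rle_Rpower_l; lra.
Qed.

Lemma is_derive_powp (p x : R) :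
  0 < x -> is_derive (powp p) x (p / x * powp p x).
Proof.
intros Hx.
apply (is_derive_ext_loc (fun y => Rpower y p)).
- exists (mkposreal x Hx). intros y Hy. apply Rabs_def2 in Hy; cbn in Hy.
  unfold minus, plus, opp in Hy; cbn in Hy. rewrite powp_pos; [easy | lra].
- rewrite powp_pos by easy. unfold Rpower.
  auto_derive; [easy |]. field; lra.
Qed.

Lemma powp_le_id (p x : R) : 1 <= p -> 0 <= x <= 1 -> powp p x <= x.
Proof.
intros Hp [Hx H1]. destruct (Req_dec x 0) as [-> | Hx0].
- rewrite powp_nonpos; lra.
- rewrite powp_pos by lra. rewrite <- (Rpower_1 x) at 2 by lra.
  unfold Rpower. apply exp_mono. assert (ln x <= 0) by (rewrite <- ln_1; apply ln_le; lra). nra.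
Qed.

Lemma locally_interval (x r : R) (P : R -> Prop) : 0 < r ->
  (forall y, x - r < y < x + r -> P y) -> locally x P.
Proof.
intros Hr H. exists (mkposreal r Hr). intros y Hy. apply Rabs_def2 in Hy. 
unfold minus, plus, opp in Hy; cbn in Hy. apply H; lra.
Qed.

Lemma continuous_powp (p x : R) : 1 <= p -> continuous (powp p) x.
Proof.
intros Hp. destruct (Rtotal_order x 0) as [H | [-> | H]].
- apply (continuous_ext_loc _ (fun _ => 0)); [| apply continuous_const].
  apply (locally_interval x (- x)); [lra|]. intros y Hy. now rewrite powp_nonpos by lra.
- apply filterlim_locally. intros e. rewrite (powp_nonpos p 0) by lra.
  apply (locally_interval 0 (Rmin 1 e)).
  { apply Rmin_pos; [lra | apply cond_pos]. }
  intros y Hy. assert (Rmin 1 e <= 1) by apply Rmin_l. assert (Rmin 1 e <= e) by apply Rmin_r.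
  change (Rabs (powp p y - 0) < e). rewrite Rminus_0_r, Rabs_right by (apply Rle_ge, powp_ge0).
  destruct (Rle_or_lt y 0) as [Hy0 | Hy0].
  + rewrite powp_nonpos by easy. apply cond_pos.
  + apply Rle_lt_trans with y; [apply powp_le_id; lra | lra].
- apply (ex_derive_continuous (V := R_NormedModule)). eexists. now apply is_derive_powp.
Qed.

(** The hypothesis [1 <= p] gives [powp p y <= y] near the origin, hence a
    derivative [0] there. *)
Lemma is_derive_id_powp (p x : R) :
  1 <= p -> is_derive (fun y => y * powp p y) x ((p + 1) * powp p x).
Proof.
intros Hp. destruct (Rtotal_order x 0) as [H | [-> | H]].
- rewrite powp_nonpos by lra. rewrite Rmult_0_r.
  apply (is_derive_ext_loc (fun _ => 0)); [| apply @is_derive_const].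
  apply (locally_interval x (- x)); [lra|]. intros y Hy. rewrite powp_nonpos, Rmult_0_r by lra. reflexivity.
- rewrite powp_nonpos by lra. rewrite Rmult_0_r.
  split; [apply @is_linear_scal_l |].
  intros z Hz e. apply @is_filter_lim_locally_unique in Hz; subst z.
  apply (locally_interval 0 (Rmin 1 e)).
  { apply Rmin_pos; [lra | apply cond_pos]. }
  intros y Hy. assert (Rmin 1 e <= 1) by apply Rmin_l. assert (Rmin 1 e <= e) by apply Rmin_r.
  change (Rabs (y * powp p y - 0 * powp p 0 - (y - 0) * 0) <= e * Rabs (y - 0)).
  replace (y * powp p y - 0 * powp p 0 - (y - 0) * 0) with (y * powp p y) by ring.
  rewrite Rminus_0_r, Rabs_mult, (Rabs_right (powp p y)) by (apply Rle_ge, powp_ge0).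
  rewrite Rmult_comm. apply Rmult_le_compat_r; [apply Rabs_pos |].
  destruct (Rle_or_lt y 0) as [Hy0 | Hy0].
  + rewrite powp_nonpos by easy. apply Rlt_le, cond_pos.
  + apply Rle_trans with y; [apply powp_le_id; lra | lra].
- replace ((p + 1) * powp p x) with (plus (mult 1 (powp p x)) (mult x (p / x * powp p x))).
  + apply @is_derive_mult; [apply @is_derive_id | now apply is_derive_powp | intros; apply Rmult_comm].
  + cbn. unfold plus, mult; cbn. field; lra.
Qed.

Lemma powp_lipschitz (p x y : R) : 1 <= p -> 0 <= x <= y -> y <= 1 ->
  powp p y - powp p x <= p * (y - x).
Proof.
intros Hp [Hx Hxy] Hy.
destruct (Req_dec x 0) as [-> | Hx0].
{ rewrite (powp_nonpos p 0) by lra. assert (powp p y <= y) by (apply powp_le_id; lra). nra. }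
destruct (MVT_gen (powp p) x y (fun z => p / z * powp p z)) as [c [Hc Heq]].
- intros z. rewrite Rmin_left, Rmax_right by lra. intros Hz. apply is_derive_powp; lra.
- intros z Hz. apply continuity_pt_filterlim, continuous_powp, Hp.
- rewrite Rmin_left, Rmax_right in Hc by lra. rewrite Heq.
  apply Rmult_le_compat_r; [lra |].
  assert (powp p c <= c) by (apply powp_le_id; lra).
  replace (p / c * powp p c) with (p * (powp p c / c)) by (field; lra).
  apply Rle_trans with (p * 1); [apply Rmult_le_compat_l; [lra |] | lra].
  apply (Rmult_le_reg_r c); [lra |]. unfold Rdiv. rewrite Rmult_assoc, Rinv_l; lra.
Qed.

(** * The damped first-order equation *)

Definition phase (a s : R) : C := (cos (a * s ^ 2 / 2), sin (a * s ^ 2 / 2)).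

Lemma Cmod_phase (a s : R) : Cmod (phase a s) = 1.
Proof.
unfold Cmod, phase; cbn [fst snd].
replace (cos (a * s ^ 2 / 2) ^ 2 + sin (a * s ^ 2 / 2) ^ 2) with 1; [apply sqrt_1 |].
rewrite <- !Rsqr_pow2, Rplus_comm. now rewrite sin2_cos2.
Qed.

Lemma Cconj_phase_mult (a s : R) : (Cconj (phase a s) * phase a s = 1)%C.
Proof.
generalize (sin2_cos2 (a * s ^ 2 / 2)). unfold Rsqr, phase, Cconj, Cmult; cbn [fst snd].
intros H. apply injective_projections; cbn [fst snd RtoC]; lra.
Qed.

Lemma is_derive_phase (a s : R) : cderive (phase a) s (Ci * RtoC (a * s) * phase a s)%C.
Proof.
apply is_derive_C_comp; unfold phase; cbn -[cos sin pow]; split; auto_derive; auto; cbn; unfold Rdiv; field.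
Qed.

Lemma is_derive_Cconj_phase (a s : R) :
  cderive (fun r => Cconj (phase a r)) s (- (Ci * RtoC (a * s)) * Cconj (phase a s))%C.
Proof.
apply is_derive_C_comp; unfold phase; cbn -[cos sin pow]; split; auto_derive; auto; cbn; unfold Rdiv; field.
Qed.

Lemma continuous_phase (a s : R) : ccont (phase a) s.
Proof. eapply cderive_ccont, is_derive_phase. Qed.

(** The solution, regular at the origin, of [y' + (m/r + i a r) y = f] by
    variation of constants. For [r <= 0] its value is [0], because the integral
    and the inverse of [powp m r] are [0]. *)
Definition damp (m a : R) (f : R -> C) (r : R) : C :=
  (Cconj (phase a r) * RtoC (/ powp m r) *
   CInt (fun s => RtoC (powp m s) * phase a s * f s) 0 r)%C.

Lemma continuous_damp_integrand (m a : R) (f : R -> C) (s : R) :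
  1 <= m -> ccont f s -> ccont (fun s => RtoC (powp m s) * phase a s * f s)%C s.
Proof.
intros Hm Hf. apply continuous_Cmult; [| easy]. apply continuous_Cmult; [| apply continuous_phase].
now apply continuous_RtoC, continuous_powp.
Qed.

Lemma damp_nonpos (m a : R) (f : R -> C) (r : R) : r <= 0 -> damp m a f r = RtoC 0.
Proof.
intros Hr. unfold damp. rewrite powp_nonpos, Rinv_0 by easy. ring.
Qed.

Lemma damp_minus (m a : R) (f g : R -> C) (r : R) : 1 <= m ->
  (forall s, ccont f s) -> (forall s, ccont g s) ->
  (damp m a f r - damp m a g r = damp m a (fun s => f s - g s) r)%C.
Proof.
intros Hm Hf Hg. unfold damp.
rewrite (RInt_ext (V := C_R_CompleteNormedModule) (fun s => RtoC (powp m s) * phase a s * (f s - g s))%C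
 (fun s => RtoC (powp m s) * phase a s * f s - RtoC (powp m s) * phase a s * g s)%C).
2: intros s _; match goal with |- ?x = ?y => change (@eq C x y) end; ring.
rewrite CInt_minus; [ring | |]; intros; now apply continuous_damp_integrand.
Qed.

(** Only the size of the kernel matters: its modulus [(s/r)^m] is at most 1 for
    [0 <= s <= r]. *)
Lemma Cmod_damp_le (m a : R) (f : R -> C) (g : R -> R) (r : R) :
  1 <= m -> 0 <= r -> (forall s, ccont f s) -> (forall s, continuous g s) ->
  (forall s, 0 <= s <= r -> Cmod (f s) <= g s) ->
  Cmod (damp m a f r) <= RInt g 0 r.
Proof.
intros Hm Hr Hf Hg H.
destruct (Req_dec r 0) as [-> | Hr0].
{ rewrite damp_nonpos, Cmod_0 by lra. rewrite RInt_point. apply Rle_refl. }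
assert (Hw : 0 < powp m r) by (apply powp_gt0; lra).
unfold damp. rewrite !Cmod_mult, Cmod_conj, Cmod_phase, Cmod_R.
rewrite Rabs_right by (apply Rle_ge, Rlt_le, Rinv_0_lt_compat, Hw).
rewrite Rmult_1_l. apply (Rmult_le_reg_l (powp m r)); [easy |].
rewrite <- Rmult_assoc, Rinv_r, Rmult_1_l by lra.
change (powp m r * RInt g 0 r) with (scal (powp m r) (RInt g 0 r)).
rewrite <- (RInt_scal (V := R_CompleteNormedModule)).
2: apply (ex_RInt_continuous (V := R_CompleteNormedModule)); intros z _; apply Hg.
apply Cmod_CInt_le; auto.
- intros; now apply continuous_damp_integrand.
- intros s. apply (continuous_mult (K := R_AbsRing)); [apply continuous_const | apply Hg].
- intros s Hs. rewrite !Cmod_mult, Cmod_phase, Cmod_R, Rmult_1_r.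
  rewrite Rabs_right by (apply Rle_ge, powp_ge0).
  apply Rmult_le_compat; [apply powp_ge0 | apply Cmod_ge_0 | apply powp_incr; lra | now apply H].
Qed.

Lemma Cmod_damp_le_const (m a : R) (f : R -> C) (B r : R) :
  1 <= m -> 0 <= r -> (forall s, ccont f s) ->
  (forall s, 0 <= s <= r -> Cmod (f s) <= B) ->
  Cmod (damp m a f r) <= B * r.
Proof.
intros Hm Hr Hf H. 
eapply Rle_trans; [apply (Cmod_damp_le m a f (fun _ => B)); auto; intros; apply continuous_const |].
rewrite RInt_const, Rminus_0_r, Rmult_comm. apply Rle_refl.
Qed.

Lemma RInt_exp (B mu r : R) : 0 < mu ->
  RInt (fun s => B * exp (mu * s)) 0 r = B / mu * (exp (mu * r) - 1).
Proof.
intros Hmu. apply is_RInt_unique.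
replace (B / mu * (exp (mu * r) - 1))
  with (minus (B / mu * exp (mu * r)) (B / mu * exp (mu * 0))).
2: { unfold minus, plus, opp; cbn. rewrite Rmult_0_r, exp_0. ring. }
apply (is_RInt_derive (fun s => B / mu * exp (mu * s))).
- intros x _. auto_derive; auto. field; lra.
- intros x _. apply (ex_derive_continuous (V := R_NormedModule)). auto_derive; auto.
Qed.

Lemma Cmod_damp_le_exp (m a : R) (f : R -> C) (B mu r : R) :
  1 <= m -> 0 <= r -> 0 <= B -> 0 < mu -> (forall s, ccont f s) ->
  (forall s, 0 <= s <= r -> Cmod (f s) <= B * exp (mu * s)) ->
  Cmod (damp m a f r) <= B / mu * exp (mu * r).
Proof.
intros Hm Hr HB Hmu Hf H.
eapply Rle_trans.
{ apply (Cmod_damp_le m a f (fun s => B * exp (mu * s))); auto. intros s.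
  apply (ex_derive_continuous (V := R_NormedModule)). auto_derive; auto. }
rewrite RInt_exp by easy.
assert (0 <= B / mu) by (apply Rdiv_le_0_compat; easy). nra.
Qed.

Lemma is_derive_damp (m a : R) (f : R -> C) (r : R) :
  1 <= m -> 0 < r -> (forall s, ccont f s) ->
  cderive (damp m a f) r
    (f r - (RtoC (m / r) + Ci * RtoC (a * r)) * damp m a f r)%C.
Proof.
intros Hm Hr Hf. assert (Hw := powp_gt0 m r Hr).
replace (f r - (RtoC (m / r) + Ci * RtoC (a * r)) * damp m a f r)%C with
 (((- (Ci * RtoC (a * r)) * Cconj (phase a r)) * RtoC (/ powp m r) +
   Cconj (phase a r) * RtoC (- (m / r * powp m r) / powp m r ^ 2)) *
   CInt (fun s => RtoC (powp m s) * phase a s * f s) 0 r +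
  Cconj (phase a r) * RtoC (/ powp m r) * (RtoC (powp m r) * phase a r * f r))%C.
- apply (is_derive_Cmult (fun r => Cconj (phase a r) * RtoC (/ powp m r))%C
    (fun r => CInt (fun s => RtoC (powp m s) * phase a s * f s)%C 0 r));
   [apply (is_derive_Cmult (fun r => Cconj (phase a r)) (fun r => RtoC (/ powp m r))) |].
  + apply is_derive_Cconj_phase.
  + apply is_derive_RtoC. apply is_derive_inv; [now apply is_derive_powp | lra].
  + apply (is_derive_CInt (fun s => RtoC (powp m s) * phase a s * f s)%C).
    intros; now apply continuous_damp_integrand.
- replace (- (m / r * powp m r) / powp m r ^ 2) with (- (m / r) * / powp m r) by (field; lra).
  replace (Cconj (phase a r) * RtoC (/ powp m r) * (RtoC (powp m r) * phase a r * f r))%C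
   with ((Cconj (phase a r) * phase a r) * (RtoC (/ powp m r) * RtoC (powp m r)) * f r)%C by ring.
  rewrite Cconj_phase_mult, <- RtoC_mult, Rinv_l by lra.
  unfold damp. rewrite (RtoC_mult (- (m / r))), RtoC_opp. ring.
Qed.

Lemma filterlim_Cmod {T : Type} (F : (T -> Prop) -> Prop) (FF : Filter F) (f : T -> C) (l : C) :
  filterlim f F (locally (T := C_UniformSpace) l) <->
  forall e, 0 < e -> F (fun y => Cmod (f y - l) < e).
Proof.
split.
- intros H e He. generalize (proj1 (filterlim_locally_ball_norm (U := C_R_NormedModule) f l) H (mkposreal e He)).
  apply filter_imp. intros y Hy. rewrite Cmod_norm. exact Hy.
- intros H. apply (filterlim_locally_ball_norm (U := C_R_NormedModule) f l).
  intros e. generalize (H e (cond_pos e)). apply filter_imp. intros y. rewrite Cmod_norm. easy.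
Qed.

Lemma locally_ball_lt (x : R) (P : R -> Prop) : locally x P ->
  exists r, 0 < r /\ forall y, x - r < y < x + r -> P y.
Proof.
intros [r H]. exists r. split; [apply cond_pos |]. intros y Hy. apply H.
apply Rabs_def1; unfold minus, plus, opp; cbn; lra.
Qed.

(** The linear function [q * r] solves the damped equation with this right-hand
    side; comparison with it yields the behaviour of [damp] at the origin
    without any expansion of the integral. *)
Lemma damp_model (m a : R) (q : C) (r : R) : 1 <= m -> 0 <= r ->
  damp m a (fun s => q * (RtoC (m + 1) + Ci * RtoC (a * s ^ 2)))%C r = (q * RtoC r)%C.
Proof.
intros Hm Hr. destruct (Req_dec r 0) as [-> | Hr0].
{ rewrite damp_nonpos by lra. ring. }
assert (Hw : 0 < powp m r) by (apply powp_gt0; lra).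
unfold damp.
rewrite (is_RInt_unique (V := C_R_CompleteNormedModule) _ 0 r (RtoC (r * powp m r) * phase a r * q)%C).
{ replace (Cconj (phase a r) * RtoC (/ powp m r) * (RtoC (r * powp m r) * phase a r * q))%C with
  ((Cconj (phase a r) * phase a r) * q * (RtoC (/ powp m r) * RtoC (r * powp m r)))%C by ring.
  rewrite Cconj_phase_mult, <- RtoC_mult.
  replace (/ powp m r * (r * powp m r)) with r by (field; lra). ring. }
replace (RtoC (r * powp m r) * phase a r * q)%C with
 (minus (RtoC (r * powp m r) * phase a r * q : C_R_CompleteNormedModule)
   (RtoC (0 * powp m 0) * phase a 0 * q))%C.
2: { rewrite Rmult_0_l. change (RtoC (r * powp m r) * phase a r * q - RtoC 0 * phase a 0 * q =
     RtoC (r * powp m r) * phase a r * q)%C. ring. }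
apply (is_RInt_derive (V := C_R_CompleteNormedModule)
  (fun s => RtoC (s * powp m s) * phase a s * q)%C).
- intros s _. 
  replace (RtoC (powp m s) * phase a s * (q * (RtoC (m + 1) + Ci * RtoC (a * s ^ 2))))%C with
  ((RtoC ((m + 1) * powp m s) * phase a s + RtoC (s * powp m s) * (Ci * RtoC (a * s) * phase a s)) * q
    + (RtoC (s * powp m s) * phase a s) * RtoC 0)%C.
  + apply (is_derive_Cmult (fun s => RtoC (s * powp m s) * phase a s)%C (fun _ => q)).
    * apply (is_derive_Cmult (fun s => RtoC (s * powp m s)) (phase a)).
      -- now apply is_derive_RtoC, is_derive_id_powp.
      -- apply is_derive_phase.
    * apply (is_derive_const (V := C_R_NormedModule)).
  + rewrite !RtoC_mult, RtoC_pow. ring.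
- intros s _. apply continuous_damp_integrand; [easy |].
  apply continuous_Cmult; [apply continuous_const |].
  apply continuous_C_comp; cbn; split;
  apply (ex_derive_continuous (V := R_NormedModule)); auto_derive; auto.
Qed.

(** The right-hand side of [damp_model] with [q = f 0 / (m + 1)] agrees with
    [f] at the origin, so that the difference of the two solutions is [o(r)].
    This is the existence of the second derivative of the profile at 0. *)
Lemma damp_near_0 (m a : R) (f : R -> C) (e : R) : 1 <= m -> (forall s, ccont f s) -> 0 < e ->
  exists r0, 0 < r0 /\ forall r, 0 <= r < r0 ->
   Cmod (damp m a f r - f 0 / RtoC (m + 1) * RtoC r) <= e * r.
Proof.
intros Hm Hf He.
assert (Hm1 : RtoC (m + 1) <> RtoC 0) by (intros E; apply RtoC_inj in E; lra).
set (q := (f 0 / RtoC (m + 1))%C).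
set (fs := (fun s => q * (RtoC (m + 1) + Ci * RtoC (a * s ^ 2)))%C).
assert (Hfs : forall s, ccont fs s).
{ intros s. apply continuous_Cmult; [apply continuous_const |].
  apply continuous_C_comp; cbn; split;
  apply (ex_derive_continuous (V := R_NormedModule)); auto_derive; auto. }
assert (Hd : forall s, ccont (fun s => f s - fs s)%C s).
{ intros s. apply (continuous_minus (V := C_R_NormedModule) f fs); auto. }
destruct (locally_ball_lt _ _ (proj1 (filterlim_Cmod _ _ _ _) (Hd 0) e He)) as [r0 [Hr0 H]].
exists r0; split; [easy |]. intros r Hr.
rewrite <- (damp_model m a q r) by easy. fold fs. rewrite damp_minus by easy.
apply Cmod_damp_le_const; [easy | easy | easy |].
intros s Hs. specialize (H s). 
replace (f s - fs s)%C with (f s - fs s - (f 0%R - fs 0%R))%C.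
{ apply Rlt_le, H; lra. }
replace (fs 0) with (f 0); [ring |].
unfold fs, q. replace (a * 0 ^ 2) with 0 by ring. field. easy.
Qed.

Lemma continuous_damp (m a : R) (f : R -> C) (r : R) : 1 <= m -> (forall s, ccont f s) ->
  ccont (damp m a f) r.
Proof.
intros Hm Hf. destruct (Rtotal_order r 0) as [H | [-> | H]].
- apply (continuous_ext_loc (U := C_UniformSpace) _ (fun _ => RtoC 0)); [| apply continuous_const].
  apply (locally_interval r (- r)); [lra|]. intros y Hy. now rewrite damp_nonpos by lra.
- apply filterlim_Cmod; [apply locally_filter |]. intros e He. rewrite (damp_nonpos m a f 0) by lra.
  destruct (damp_near_0 m a f 1 Hm Hf Rlt_0_1) as [r0 [Hr0 H]].
  set (K := Cmod (f 0 / RtoC (m + 1)) + 1).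
  assert (HK : 0 < K). { unfold K. generalize (Cmod_ge_0 (f 0 / RtoC (m + 1))). lra. }
  apply (locally_interval 0 (Rmin r0 (e / K))).
  { apply Rmin_pos; [easy | now apply Rdiv_lt_0_compat]. }
  intros y Hy. assert (Rmin r0 (e / K) <= r0) by apply Rmin_l.
  assert (Rmin r0 (e / K) <= e / K) by apply Rmin_r.
  destruct (Rle_or_lt y 0) as [Hy0 | Hy0].
  { rewrite damp_nonpos by easy. replace (0 - 0)%C with (RtoC 0) by ring. now rewrite Cmod_0. }
  replace (damp m a f y - 0)%C with
    ((damp m a f y - f 0 / RtoC (m + 1) * RtoC y) + f 0 / RtoC (m + 1) * RtoC y)%C by ring.
  eapply Rle_lt_trans; [apply Cmod_triangle |].
  rewrite Cmod_mult, Cmod_R, (Rabs_right y) by lra.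
  assert (Cmod (damp m a f y - f 0 / RtoC (m + 1) * RtoC y) <= 1 * y) by (apply H; lra).
  assert (K * y < e). { apply Rmult_lt_reg_r with (/ K); [now apply Rinv_0_lt_compat |].
    replace (K * y * / K) with y by (field; lra). unfold Rdiv in *. lra. }
  unfold K in *. lra.
- eapply cderive_ccont. now apply is_derive_damp.
Qed.


(** * Existence by Picard iteration *)

Lemma half_pow_small (B e : R) : 0 < e -> exists n, B * (/ 2) ^ n < e.
Proof.
intros He.
destruct (Rle_or_lt B 0) as [HB | HB].
{ exists 0%nat. cbn; lra. }
destruct (pow_lt_1_zero (/ 2)) with (y := e / B) as [n Hn].
- rewrite Rabs_right; lra.
- now apply Rdiv_lt_0_compat.
- exists n. specialize (Hn n (le_n n)). rewrite Rabs_right in Hn.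
  + apply Rmult_lt_reg_r with (/ B); [now apply Rinv_0_lt_compat |].
    replace (B * (/ 2) ^ n * / B) with ((/ 2) ^ n) by (field; lra). exact Hn.
  + apply Rle_ge, pow_le; lra.
Qed.

(** Banach's fixed point theorem in the weighted sup norm of [w], started at 0.
    Since the iterates converge geometrically, the limit inherits an explicit
    bound, linear in the size [A] of the first iterate. *)
Lemma weighted_fixed_point (T : (R -> C) -> R -> C) (w : R -> R) (A : R) :
  (forall s, 0 < w s) -> (forall s, continuous w s) ->
  (forall f, (forall s, ccont f s) -> forall s, ccont (T f) s) ->
  (forall f g B, (forall s, ccont f s) -> (forall s, ccont g s) -> 0 <= B ->
     (forall s, Cmod (f s - g s) <= B * w s) ->
     forall s, Cmod (T f s - T g s) <= B / 2 * w s) ->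
  (forall s, Cmod (T (fun _ => RtoC 0) s) <= A * w s) ->
  exists q : R -> C, (forall s, ccont q s) /\ (forall s, T q s = q s) /\
    (forall s, Cmod (q s) <= 2 * A * w s).
Proof.
intros Hw0 Hw HT HL HA.
set (u := fun n => Nat.iter n T (fun _ => RtoC 0)).
assert (A0 : 0 <= A).
{ apply Rmult_le_reg_r with (w 0); [easy |]. rewrite Rmult_0_l.
  eapply Rle_trans; [apply Cmod_ge_0 | apply (HA 0)]. }
assert (Hp : forall n, 0 <= (/ 2) ^ n) by (intros; apply pow_le; lra).
assert (Hu : forall n s, ccont (u n) s).
{ induction n; intros s; [apply continuous_const | now apply HT]. }
assert (Hstep : forall n s, Cmod (u (S n) s - u n s) <= A * (/ 2) ^ n * w s).
{ induction n; intros s.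
  - cbn. replace (T (fun _ => RtoC 0) s - 0)%C with (T (fun _ => RtoC 0) s) by ring.
    rewrite Rmult_1_r. apply HA.
  - replace (A * (/ 2) ^ S n * w s) with (A * (/ 2) ^ n / 2 * w s) by (cbn; field).
    change (Cmod (T (u (S n)) s - T (u n) s) <= A * (/ 2) ^ n / 2 * w s).
    apply HL; auto. now apply Rmult_le_pos. }
assert (Hdiff : forall k n s, Cmod (u (k + n)%nat s - u n s) <= 2 * A * (/ 2) ^ n * (1 - (/ 2) ^ k) * w s).
{ induction k; intros n s.
  - cbn [Nat.add pow]. replace (u n s - u n s)%C with (RtoC 0) by ring. rewrite Cmod_0. lra.
  - replace (u (S k + n)%nat s - u n s)%C with
      ((u (S (k + n)) s - u (k + n)%nat s) + (u (k + n)%nat s - u n s))%C by (cbn [Nat.add]; ring).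
    eapply Rle_trans; [apply Cmod_triangle |].
    generalize (Hstep (k + n)%nat s) (IHk n s). rewrite pow_add.
    cbn [pow]. lra. }
assert (Hdiff' : forall k n s, Cmod (u (k + n)%nat s - u n s) <= 2 * A * (/ 2) ^ n * w s).
{ intros k n s. eapply Rle_trans; [apply Hdiff |].
  apply Rmult_le_compat_r; [now apply Rlt_le |].
  rewrite <- (Rmult_1_r (2 * A * (/ 2) ^ n)) at 2.
  apply Rmult_le_compat_l; [apply Rmult_le_pos; [lra | apply Hp] |]. generalize (Hp k); lra. }
set (F := fun s => filtermap (fun n => u n s : C_R_CompleteNormedModule) eventually).
set (q := fun s => lim (F s) : C).
assert (Hlim : forall s, filterlim (fun n => u n s) eventually (locally (T := C_UniformSpace) (q s))).
{ intros s. apply (filterlim_locally (U := C_R_CompleteNormedModule)).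
  intros e. apply (complete_cauchy (F s)).
  - unfold F. apply filtermap_proper_filter, eventually_filter.
  - intros d. destruct (half_pow_small (2 * A * w s) d (cond_pos d)) as [n Hn].
    exists (u n s). exists n. intros k Hk.
    apply (norm_compat1 (V := C_R_NormedModule)).
    change (norm (u k s - u n s : C_R_NormedModule)%C < d). rewrite <- Cmod_norm.
    replace k with (k - n + n)%nat by (apply Nat.sub_add, Hk).
    eapply Rle_lt_trans; [apply Hdiff' |]. lra. }
assert (Hq : forall n s, Cmod (q s - u n s) <= 2 * A * (/ 2) ^ n * w s).
{ intros n s. apply Rnot_lt_le. intros H.
  set (e := Cmod (q s - u n s) - 2 * A * (/ 2) ^ n * w s).
  destruct (proj1 (filterlim_Cmod _ _ _ _) (Hlim s) e) as [N HN]; [unfold e; lra |].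
  specialize (HN (N + n)%nat (Nat.le_add_r _ _)).
  specialize (Hdiff' N n s).
  assert (Cmod (q s - u n s) <= Cmod (u (N + n)%nat s - q s) + Cmod (u (N + n)%nat s - u n s)).
  { rewrite <- (Cmod_opp (u (N + n)%nat s - q s)).
    replace (q s - u n s)%C with (- (u (N + n)%nat s - q s) + (u (N + n)%nat s - u n s))%C by ring.
    apply Cmod_triangle. }
  unfold e in HN. lra. }
assert (Hqc : forall s, ccont q s).
{ intros s. apply filterlim_Cmod; [apply locally_filter |]. intros e He.
  destruct (half_pow_small (2 * A * (w s + 1)) (e / 3)) as [n Hn]; [lra |].
  generalize (proj1 (filterlim_Cmod _ _ _ _) (Hu n s) (e / 3) ltac:(lra)).
  generalize (proj1 (filterlim_locally _ _) (Hw s) (mkposreal 1 Rlt_0_1)).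
  intros H1 H2. generalize (filter_and _ _ H1 H2). apply filter_imp. clear H1 H2.
  intros y [H1 H2]. apply Rabs_def2 in H1; unfold minus, plus, opp in H1; cbn in H1.
  replace (q y - q s)%C with ((q y - u n y) + ((u n y - u n s) + - (q s - u n s)))%C by ring.
  eapply Rle_lt_trans; [apply Cmod_triangle |].
  eapply Rle_lt_trans; [apply Rplus_le_compat_l, Cmod_triangle |]. rewrite Cmod_opp.
  assert (HAn : 0 <= 2 * A * (/ 2) ^ n) by (apply Rmult_le_pos; [lra | apply Hp]).
  assert (Cmod (q y - u n y) < e / 3).
  { eapply Rle_lt_trans; [apply Hq |]. nra. }
  assert (Cmod (q s - u n s) < e / 3).
  { eapply Rle_lt_trans; [apply Hq |]. nra. }
  lra. }
exists q. split; [easy |]. split.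
- intros s. 
  assert (H : Cmod (T q s - q s) <= 0).
  { apply Rnot_lt_le. intros H. 
    destruct (half_pow_small (2 * A * w s) _ H) as [n Hn].
    assert (H1 : Cmod (T q s - u (S n) s) <= 2 * A * (/ 2) ^ n / 2 * w s).
    { change (u (S n)) with (T (u n)). apply HL; auto. apply Rmult_le_pos; [lra | apply Hp]. }
    assert (H2 := Hq (S n) s). cbn [pow] in H2.
    assert (Cmod (T q s - q s) <= Cmod (T q s - u (S n) s) + Cmod (q s - u (S n) s)).
    { rewrite <- (Cmod_opp (q s - u (S n) s)).
      replace (T q s - q s)%C with ((T q s - u (S n) s) + - (q s - u (S n) s))%C by ring.
      apply Cmod_triangle. }
    lra. }
  assert (E : Cmod (T q s - q s) = 0) by (apply Rle_antisym; [easy | apply Cmod_ge_0]).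
  apply Cmod_eq_0 in E. replace (T q s) with ((T q s - q s) + q s)%C by ring. rewrite E. ring.
- intros s. generalize (Hq 0%nat s). change (u 0%nat s) with (RtoC 0). replace (q s - 0)%C with (q s) by ring.
  rewrite pow_O. lra.
Qed.
Lemma CInt_zero (f : R -> C) (a b : R) :
  (forall s, Rmin a b < s < Rmax a b -> f s = RtoC 0) -> CInt f a b = RtoC 0.
Proof.
intros H. rewrite (RInt_ext (V := C_R_CompleteNormedModule) _ (fun _ => RtoC 0)) by exact H.
rewrite RInt_const. apply (scal_zero_r (V := C_R_NormedModule)).
Qed.

(** In the weight [exp(2 L s)] each of the two integrations gains a factor
    [1/(2 L)]; since [1 <= L], the product with the Lipschitz constant [L] is
    below 1/2. The bound proportional
    to [eps] makes small data stay small on bounded intervals. *)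
Lemma damped_ivp (m a eps L : R) (N : R -> C -> C) :
  1 <= m -> 0 <= eps -> 1 <= L ->
  (forall s, N s (RtoC 0) = RtoC 0) ->
  (forall s p q, Cmod (N s p - N s q) <= L * Cmod (p - q)) ->
  (forall q, (forall s, ccont q s) -> forall s, ccont (fun s => N s (q s)) s) ->
  exists q : R -> C, (forall s, ccont q s) /\
    (forall s, q s = RtoC eps + CInt (damp m a (fun r => N r (q r))) 0 s)%C /\
    (forall s, 0 <= s -> Cmod (q s) <= 2 * eps * exp (2 * L * s)).
Proof.
intros Hm Heps HL HN0 HNL HNc.
set (T := fun (q : R -> C) s => (RtoC eps + CInt (damp m a (fun r => N r (q r))) 0 s)%C).
assert (Hdc : forall q, (forall s, ccont q s) -> forall s, ccont (damp m a (fun r => N r (q r))) s).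
{ intros q Hq s. apply continuous_damp; [easy |]. now apply HNc. }
assert (Hneg : forall f s, s <= 0 -> T f s = RtoC eps).
{ intros f s Hs. unfold T. rewrite CInt_zero; [ring |].
  intros r. rewrite Rmin_right, Rmax_left by easy. intros Hr. apply damp_nonpos; lra. }
destruct (weighted_fixed_point T (fun s => exp (2 * L * Rabs s)) eps) as [q [Hq [HTq Hb]]].
- intros s; apply exp_pos.
- intros s. apply (continuous_comp (fun s => 2 * L * Rabs s) exp).
  + apply (continuous_scal_r (V := R_NormedModule) (2 * L) Rabs), continuous_Rabs.
  + apply (ex_derive_continuous (V := R_NormedModule)). auto_derive; auto.
- intros f Hf s. apply (continuous_plus (V := C_R_NormedModule) (fun _ => RtoC eps)).
  + apply continuous_const.
  + eapply cderive_ccont. apply is_derive_CInt. now apply Hdc.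
- intros f g B Hf Hg HB Hfg s.
  destruct (Rle_or_lt s 0) as [Hs | Hs].
  { rewrite !Hneg by easy. replace (eps - eps)%C with (RtoC 0) by ring. rewrite Cmod_0.
    apply Rmult_le_pos; [lra | apply Rlt_le, exp_pos]. }
  rewrite Rabs_right by lra. unfold T.
  replace (RtoC eps + CInt (damp m a (fun r => N r (f r))) 0 s -
    (RtoC eps + CInt (damp m a (fun r => N r (g r))) 0 s))%C with
   (CInt (damp m a (fun r => N r (f r))) 0 s - CInt (damp m a (fun r => N r (g r))) 0 s)%C by ring.
  rewrite <- CInt_minus by auto.
  apply Rle_trans with (RInt (fun r => L * B / (2 * L) * exp (2 * L * r)) 0 s).
  + apply Cmod_CInt_le; [| | lra |].
    * intros r. apply (continuous_minus (V := C_R_NormedModule)); auto; now apply Hdc.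
    * intros r. apply (ex_derive_continuous (V := R_NormedModule)). auto_derive; auto.
    * intros r Hr. rewrite damp_minus by auto.
      apply Cmod_damp_le_exp; [easy | lra | nra | lra | |].
      -- intros t. apply (continuous_minus (V := C_R_NormedModule)
           (fun s => N s (f s)) (fun s => N s (g s))); now apply HNc.
      -- intros t Ht. eapply Rle_trans; [apply HNL |].
         rewrite Rmult_assoc. apply Rmult_le_compat_l; [lra |].
         generalize (Hfg t). now rewrite Rabs_right by lra.
  + rewrite RInt_exp by lra.
    assert (0 < exp (2 * L * s)) by apply exp_pos.
    replace (L * B / (2 * L) / (2 * L)) with (B / 2 * / (2 * L)) by (field; lra).
    assert (0 < / (2 * L)) by (apply Rinv_0_lt_compat; lra).
    assert (/ (2 * L) <= 1). { rewrite <- Rinv_1. apply Rinv_le_contravar; lra. }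
    apply Rle_trans with (B / 2 * / (2 * L) * exp (2 * L * s)).
    * apply Rmult_le_compat_l; [nra | lra].
    * apply Rmult_le_compat_r; nra.
- intros s. unfold T. rewrite CInt_zero.
  + rewrite Cplus_0_r, Cmod_R, Rabs_right by lra.
    assert (exp 0 <= exp (2 * L * Rabs s)) by (apply exp_mono; generalize (Rabs_pos s); nra).
    rewrite exp_0 in *. nra.
  + intros r _. destruct (Rle_or_lt r 0) as [Hr | Hr]; [now apply damp_nonpos |].
    apply Cmod_eq_0, Rle_antisym; [| apply Cmod_ge_0].
    apply Rle_trans with (0 * r); [| lra]. apply Cmod_damp_le_const; [easy | lra | |].
    * apply HNc. intros; apply continuous_const.
    * intros t _. rewrite HN0, Cmod_0. lra.
- exists q. split; [easy |]. split.
  + intros s. symmetry. apply HTq.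
  + intros s Hs. generalize (Hb s). now rewrite Rabs_right by lra.
Qed.

(** * Regularity up to the origin *)

Lemma within_ray_proper (x : R) : 0 <= x -> ProperFilter (within ray (locally x)).
Proof.
intros Hx. split.
- intros P [e H]. exists x. apply H; [apply ball_center | exact Hx].
- apply within_filter, locally_filter.
Qed.

Lemma is_filter_lim_within_ray (x : R) : is_filter_lim (within ray (locally x)) x.
Proof. intros P. apply filter_le_within. Qed.

Lemma cderive_on_ray (f : R -> C) (x : R) (l : C) : 0 <= x -> cderive f x l ->
  filterdiff (U := R_NormedModule) (V := C_R_NormedModule)
    f (within ray (locally x)) (fun y : R => scal y l).
Proof.
intros Hx H. apply (@filterdiff_locally R_AbsRing R_NormedModule C_R_NormedModule _
  (within_ray_proper x Hx) f x); [apply is_filter_lim_within_ray | exact H].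
Qed.

(** The equation gives the derivative of [damp m a f] away from the origin; the
    value at the origin is the one found in [damp_near_0]. *)
Definition damp_deriv (m a : R) (f : R -> C) (r : R) : C :=
  if Rle_dec r 0 then (f 0 / RtoC (m + 1))%C
  else (f r - (RtoC (m / r) + Ci * RtoC (a * r)) * damp m a f r)%C.

Lemma is_derive_CInt_damp (m a eps : R) (f q : R -> C) (x : R) : 1 <= m -> (forall s, ccont f s) ->
  (forall s, q s = RtoC eps + CInt (damp m a f) 0 s)%C -> cderive q x (damp m a f x).
Proof.
intros Hm Hf Hq.
apply (is_derive_ext (V := C_R_NormedModule) (fun s => RtoC eps + CInt (damp m a f) 0 s)%C).
{ intros; now rewrite Hq. }
replace (damp m a f x) with (plus (zero : C_R_NormedModule) (damp m a f x)) by apply plus_zero_l.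
apply (is_derive_plus (V := C_R_NormedModule) (fun _ => RtoC eps)).
- apply (is_derive_const (V := C_R_NormedModule)).
- apply is_derive_CInt. intros; now apply continuous_damp.
Qed.

Lemma damp_is_C2 (m a eps : R) (f q : R -> C) : 1 <= m -> (forall s, ccont f s) ->
  (forall s, q s = RtoC eps + CInt (damp m a f) 0 s)%C ->
  is_C2_on_ray q (damp m a f) (damp_deriv m a f).
Proof.
intros Hm Hf Hq. split; [| split].
- intros x Hx. apply cderive_on_ray; [easy |]. now apply (is_derive_CInt_damp m a eps).
- intros x Hx. destruct (Req_dec x 0) as [-> | Hx0].
  + split; [apply @is_linear_scal_l |]. intros z Hz e.
    assert (E := @is_filter_lim_unique R_AbsRing R_NormedModule _
     (Proper_StrongProper _ (within_ray_proper 0 Hx)) z 0 Hz (is_filter_lim_within_ray 0)).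
    subst z. destruct (damp_near_0 m a f e Hm Hf (cond_pos e)) as [r0 [Hr0 H]].
    apply (locally_interval 0 r0); [easy |]. intros y Hy Hy0.
    unfold ray in Hy0. rewrite <- Cmod_norm.
    unfold damp_deriv. destruct (Rle_dec 0 0) as [_ | E]; [| now elim E; apply Rle_refl].
    rewrite (damp_nonpos m a f 0) by apply Rle_refl.
    match goal with |- Cmod ?A <= _ * ?B =>
      replace A with (damp m a f y - f 0%R / RtoC (m + 1) * RtoC y)%C; [replace B with y |] end.
    * apply H; lra.
    * change (y = Rabs (y - 0)). rewrite Rabs_right; lra.
    * change (minus y 0) with (y - 0).
      generalize (damp m a f y) (f 0 / RtoC (m + 1))%C. intros [u1 u2] [v1 v2].
      apply injective_projections; cbn; unfold mult, plus, opp, scal; cbn; unfold mult; cbn; ring.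
  + apply cderive_on_ray; [easy |]. unfold damp_deriv.
    destruct (Rle_dec x 0); [lra |]. apply is_derive_damp; auto; lra.
- intros x Hx. destruct (Req_dec x 0) as [-> | Hx0].
  + apply filterlim_Cmod; [apply within_filter, locally_filter |]. intros e He.
    set (l := (f 0 / RtoC (m + 1))%C).
    assert (Hm1 : RtoC (m + 1) <> RtoC 0) by (intros E; apply RtoC_inj in E; lra).
    assert (He' : 0 < e / (3 * m)) by (apply Rdiv_lt_0_compat; lra).
    destruct (damp_near_0 m a f _ Hm Hf He') as [r0 [Hr0 H]].
    generalize (proj1 (filterlim_Cmod _ _ _ _) (Hf 0) (e / 3) ltac:(lra)).
    assert (Hk : ccont (fun r => Ci * RtoC (a * r) * damp m a f r)%C 0).
    { apply continuous_Cmult; [| now apply continuous_damp].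
      apply continuous_C_comp; cbn; split;
      apply (ex_derive_continuous (V := R_NormedModule)); auto_derive; auto. }
    generalize (proj1 (filterlim_Cmod _ _ _ _) Hk (e / 3) ltac:(lra)). intros H1 H2.
    assert (H3 : locally 0 (fun y => y < r0)) by (apply (locally_interval 0 r0); [easy | intros; lra]).
    unfold within. generalize (filter_and _ _ H1 (filter_and _ _ H2 H3)).
    apply filter_imp. clear H1 H2 H3. intros y [H1 [H2 H3]] Hy. unfold ray in Hy.
    unfold damp_deriv at 2. destruct (Rle_dec 0 0) as [_ | E]; [| now elim E; apply Rle_refl].
    fold l. unfold damp_deriv. destruct (Rle_dec y 0) as [Hy0 | Hy0].
    { fold l. replace (l - l)%C with (RtoC 0) by ring. now rewrite Cmod_0. }
    assert (Hy1 : RtoC y <> RtoC 0) by (intros E; apply RtoC_inj in E; lra).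
    (* [m/y * damp] tends to [m l], and [f 0 - m l = l]. *)
    replace (f y - (RtoC (m / y) + Ci * RtoC (a * y)) * damp m a f y - l)%C with
     ((f y - f 0%R) + (- (RtoC (m / y) * (damp m a f y - l * RtoC y)) + 
       - (Ci * RtoC (a * y) * damp m a f y - Ci * RtoC (a * 0) * damp m a f 0)))%C.
    2: { rewrite (damp_nonpos m a f 0) by lra. unfold l.
         rewrite RtoC_div by lra. rewrite RtoC_plus in *. field. split; easy. }
    eapply Rle_lt_trans; [apply Cmod_triangle |].
    eapply Rle_lt_trans; [apply Rplus_le_compat_l, Cmod_triangle |]. rewrite !Cmod_opp.
    assert (Cmod (RtoC (m / y) * (damp m a f y - l * RtoC y)) <= e / 3).
    { rewrite Cmod_mult, Cmod_R, Rabs_right by (apply Rle_ge, Rdiv_le_0_compat; lra).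
      replace (e / 3) with (m / y * (e / (3 * m) * y)) by (field; lra).
      apply Rmult_le_compat_l; [apply Rdiv_le_0_compat; lra |]. apply H; lra. }
    lra.
  + apply (filterlim_filter_le_1 (F := locally x)); [apply filter_le_within |].
    change (ccont (damp_deriv m a f) x). unfold ray in Hx.
    apply (continuous_ext_loc (U := C_UniformSpace) _
      (fun r => f r - (RtoC (m / r) + Ci * RtoC (a * r)) * damp m a f r)%C).
    { apply (locally_interval x x); [lra |]. intros y Hy. unfold damp_deriv.
      destruct (Rle_dec y 0); [lra | easy]. }
    apply (continuous_minus (V := C_R_NormedModule) f); [apply Hf |].
    apply continuous_Cmult; [| now apply continuous_damp].
    apply continuous_C_comp; cbn; split;
    apply (ex_derive_continuous (V := R_NormedModule)); auto_derive; auto.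
Qed.

(** * The truncated nonlinearity *)

Lemma continuous_Rmin (f g : R -> R) (x : R) :
  continuous f x -> continuous g x -> continuous (fun y => Rmin (f y) (g y)) x.
Proof.
intros Hf Hg.
apply (continuous_ext (fun y => / 2 * (f y + g y - Rabs (f y - g y)))).
{ intros y. destruct (Rle_or_lt (f y) (g y)).
  - rewrite Rmin_left, Rabs_left1 by lra. lra.
  - rewrite Rmin_right, Rabs_right by lra. lra. }
apply (continuous_scal_r (V := R_NormedModule)).
apply (continuous_minus (V := R_NormedModule)).
- now apply (continuous_plus (V := R_NormedModule)).
- apply (continuous_comp (fun y => f y - g y) Rabs); [| apply continuous_Rabs].
  now apply (continuous_minus (V := R_NormedModule)).
Qed.

(** The a priori decay rate of the profile, used as the truncation level. *)
Definition cutoff (b s : R) : R := Rpower (Rmax 1 s) (- b).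

Lemma cutoff_gt0 (b s : R) : 0 < cutoff b s.
Proof. apply exp_pos. Qed.

Lemma cutoff_le (b s t : R) : 0 <= b -> s <= t -> cutoff b t <= cutoff b s.
Proof.
intros Hb H. unfold cutoff, Rpower. apply exp_mono.
assert (Rmax 1 s <= Rmax 1 t) by (apply Rle_max_compat_l, H).
assert (1 <= Rmax 1 s) by apply Rmax_l.
assert (ln (Rmax 1 s) <= ln (Rmax 1 t)) by (apply ln_le; lra). nra.
Qed.

Lemma cutoff_le1 (b s : R) : 0 <= b -> cutoff b s <= 1.
Proof.
intros Hb. unfold cutoff, Rpower. apply Rle_trans with (exp 0); [apply exp_mono | rewrite exp_0; lra].
assert (1 <= Rmax 1 s) by apply Rmax_l.
assert (0 <= ln (Rmax 1 s)) by (rewrite <- ln_1; apply ln_le; lra). nra.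
Qed.

Lemma continuous_cutoff (b s : R) : continuous (cutoff b) s.
Proof.
apply (continuous_comp (fun s => Rmax 1 s) (fun y => Rpower y (- b))).
- apply (continuous_ext (fun y => - Rmin (- (1)) (- y))).
  + intros y. rewrite <- Ropp_Rmax. apply Ropp_involutive.
  + apply (continuous_opp (V := R_NormedModule)). apply continuous_Rmin; [apply continuous_const |].
    apply (continuous_opp (V := R_NormedModule)), continuous_id.
- apply (ex_derive_continuous (V := R_NormedModule)). unfold Rpower. auto_derive.
  apply Rlt_le_trans with 1; [lra | apply Rmax_l].
Qed.

(** The factor [|q|^p] of the nonlinearity, with [|q|] truncated at [rho]. It
    is at most [rho^p], whatever [q] is. *)
Definition potential (p rho : R) (q : C) : R := powp p (Rmin (Cmod q) rho).

Lemma potential_le (p rho : R) (q : C) : 0 <= p -> potential p rho q <= powp p rho.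
Proof. intros Hp. apply powp_incr; [easy | apply Rmin_r]. Qed.

Lemma potential_ge0 (p rho : R) (q : C) : 0 <= potential p rho q.
Proof. apply powp_ge0. Qed.

Lemma powp_le1 (p x : R) : 0 <= p -> x <= 1 -> powp p x <= 1.
Proof.
intros Hp Hx. replace 1 with (powp p 1); [now apply powp_incr |].
rewrite powp_pos by lra. unfold Rpower. rewrite ln_1, Rmult_0_r. apply exp_0.
Qed.

(** When the two potentials differ, the smaller vector lies below the truncation
    level, so its modulus is at most 1 and multiplies a Lipschitz difference. *)
Lemma potential_lipschitz_aux (p rho : R) (q r : C) : 1 <= p -> 0 <= rho <= 1 ->
  Cmod r <= Cmod q ->
  Cmod (RtoC (potential p rho q) * q - RtoC (potential p rho r) * r) <= (1 + p) * Cmod (q - r).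
Proof.
intros Hp [Hr0 Hr1] Hqr.
replace (RtoC (potential p rho q) * q - RtoC (potential p rho r) * r)%C with
 (RtoC (potential p rho q) * (q - r) + RtoC (potential p rho q - potential p rho r) * r)%C
 by (rewrite RtoC_minus; ring).
eapply Rle_trans; [apply Cmod_triangle |]. rewrite !Cmod_mult, !Cmod_R.
rewrite (Rabs_right (potential p rho q)) by (apply Rle_ge, potential_ge0).
rewrite Rmult_plus_distr_r. apply Rplus_le_compat.
- apply Rmult_le_compat_r; [apply Cmod_ge_0 |].
  eapply Rle_trans; [apply potential_le; lra | apply powp_le1; lra].
- assert (Hd : 0 <= Cmod (q - r)) by apply Cmod_ge_0.
  destruct (Rle_or_lt rho (Cmod r)) as [H | H].
  + unfold potential. rewrite !Rmin_right by lra.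
    rewrite Rminus_diag, Rabs_R0. nra.
  + unfold potential. rewrite (Rmin_left (Cmod r)) by lra.
    assert (Hm : Cmod r <= Rmin (Cmod q) rho) by (apply Rmin_glb; lra).
    assert (Hm1 : Rmin (Cmod q) rho <= 1) by (apply Rle_trans with rho; [apply Rmin_r | easy]).
    assert (Hi : powp p (Cmod r) <= powp p (Rmin (Cmod q) rho)) by (apply powp_incr; lra).
    assert (Hl := powp_lipschitz p (Cmod r) (Rmin (Cmod q) rho) Hp (conj (Cmod_ge_0 r) Hm) Hm1).
    rewrite Rabs_right by lra.
    assert (Ht : Cmod q <= Cmod (q - r) + Cmod r).
    { replace q with ((q - r) + r)%C at 1 by ring. apply Cmod_triangle. }
    assert (Rmin (Cmod q) rho <= Cmod q) by apply Rmin_l.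
    assert (0 <= Cmod r) by apply Cmod_ge_0.
    apply Rle_trans with ((powp p (Rmin (Cmod q) rho) - powp p (Cmod r)) * 1).
    * apply Rmult_le_compat_l; lra.
    * nra.
Qed.

Lemma potential_lipschitz (p rho : R) (q r : C) : 1 <= p -> 0 <= rho <= 1 ->
  Cmod (RtoC (potential p rho q) * q - RtoC (potential p rho r) * r) <= (1 + p) * Cmod (q - r).
Proof.
intros Hp Hr. destruct (Rle_or_lt (Cmod r) (Cmod q)) as [H | H].
- now apply potential_lipschitz_aux.
- rewrite <- (Cmod_opp (q - r)), <- Cmod_opp.
  replace (- (RtoC (potential p rho q) * q - RtoC (potential p rho r) * r))%C with
   (RtoC (potential p rho r) * r - RtoC (potential p rho q) * q)%C by ring.
  replace (- (q - r))%C with (r - q)%C by ring.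
  apply potential_lipschitz_aux; lra.
Qed.

Lemma continuous_potential (p : R) (rho : R -> R) (q : R -> C) (s : R) : 1 <= p ->
  continuous rho s -> ccont q s -> continuous (fun r => potential p (rho r) (q r)) s.
Proof.
intros Hp Hr Hq. apply (continuous_comp (fun r => Rmin (Cmod (q r)) (rho r)) (powp p)).
- apply continuous_Rmin; [now apply continuous_Cmod | easy].
- now apply continuous_powp.
Qed.

(** With [p = 2 sigma] and [b = 1 / sigma] the truncated potential decays like
    [s^(-2)], which is integrable at infinity. *)
Lemma powp_cutoff (b p s : R) : p * b = 2 -> 1 <= s -> powp p (cutoff b s) = / s ^ 2.
Proof.
intros Hpb Hs. rewrite powp_pos by apply cutoff_gt0. unfold cutoff.
rewrite Rmax_right by easy. rewrite Rpower_mult. replace (- b * p) with (- (2)) by lra.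
rewrite Rpower_Ropp. f_equal. replace 2 with (INR 2) at 1 by (cbn; ring).
apply Rpower_pow; lra.
Qed.

(** * Energy estimate at infinity *)

Lemma derive_nonpos_decr (f df : R -> R) (x y : R) : x <= y ->
  (forall z, x <= z <= y -> is_derive f z (df z)) ->
  (forall z, x <= z <= y -> df z <= 0) -> f y <= f x.
Proof.
intros Hxy Hd Hn. destruct (MVT_gen f x y df) as [c [Hc Heq]].
- intros z; rewrite Rmin_left, Rmax_right by easy. intros Hz; apply Hd; lra.
- intros z; rewrite Rmin_left, Rmax_right by easy. intros Hz.
  apply continuity_pt_filterlim. apply (ex_derive_continuous (V := R_NormedModule)).
  eexists. now apply Hd.
- rewrite Rmin_left, Rmax_right in Hc by easy. generalize (Hn c Hc). nra.
Qed.

(** The integrating factor is [exp(K/z)], bounded at infinity because [K/z^2]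
    is integrable. *)
Lemma gronwall_inv_square (F dF : R -> R) (K x y : R) : 0 < x <= y ->
  (forall z, x <= z <= y -> is_derive F z (dF z)) ->
  (forall z, x <= z <= y -> dF z <= K / z ^ 2 * F z) -> 
  F y * exp (K / y) <= F x * exp (K / x).
Proof.
intros Hxy Hd Hn.
apply (derive_nonpos_decr (fun z => F z * exp (K / z))
  (fun z => exp (K / z) * (dF z - K / z ^ 2 * F z))); [lra | |].
- intros z Hz. 
  replace (exp (K / z) * (dF z - K / z ^ 2 * F z)) with
   (plus (mult (dF z) (exp (K / z))) (mult (F z) (- K / z ^ 2 * exp (K / z)))).
  + apply (is_derive_mult F (fun z => exp (K / z))); [now apply Hd | | intros; apply Rmult_comm].
    auto_derive; [lra |]. unfold Rdiv. field; lra.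
  + unfold plus, mult; cbn -[pow]. field; lra.
- intros z Hz. specialize (Hn z Hz). assert (0 < exp (K / z)) by apply exp_pos. nra.
Qed.

(** With [R = u + i v] and [R' = p + i w] the hypotheses say
    [R'' + i a x R' = (1 + g) R]. The energy [|R'|^2 - |R|^2] alone is
    indefinite, and so is the mass; the functional [F] below is the energy plus
    twice the mass divided by [a x / 2]. Its derivative is [O(x^(-2))] times
    itself: the rotation [i a x R'] drops out of the energy, and the terms
    [4 Re(conj(R) R')] cancel between [2 |R|^2] and the mixed term. *)
Lemma oscillator_energy_bound (a G X0 : R) (u v p w g : R -> R) :
  0 < a -> 0 < X0 -> 4 / a <= X0 ->
  (forall x, X0 <= x -> is_derive u x (p x)) ->
  (forall x, X0 <= x -> is_derive v x (w x)) ->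
  (forall x, X0 <= x -> is_derive p x ((1 + g x) * u x + a * x * w x)) ->
  (forall x, X0 <= x -> is_derive w x ((1 + g x) * v x - a * x * p x)) ->
  (forall x, X0 <= x -> Rabs (g x) <= G / x ^ 2) ->
  forall x, X0 <= x ->
   u x ^ 2 + v x ^ 2 + p x ^ 2 + w x ^ 2 <=
   3 * exp ((2 * G + 4 / a) / X0) * (u X0 ^ 2 + v X0 ^ 2 + p X0 ^ 2 + w X0 ^ 2).
Proof.
intros Ha HX0 HX Hu Hv Hp Hw Hg.
set (n := fun x => u x ^ 2 + v x ^ 2 + p x ^ 2 + w x ^ 2).
set (F := fun x => n x + 4 / (a * x) * (u x * w x - v x * p x)).
set (K := 2 * G + 4 / a).
assert (Hax : forall x, X0 <= x -> 0 < 4 / (a * x) <= 1).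
{ intros x Hx. assert (0 < a * x) by nra. split; [apply Rdiv_lt_0_compat; lra |].
  apply Rmult_le_reg_r with (a * x); [easy |].
  replace (4 / (a * x) * (a * x)) with 4 by (field; nra).
  replace 4 with (a * (4 / a)) by (field; lra). nra. }
assert (Hm : forall x, Rabs (u x * w x - v x * p x) <= n x / 2).
{ intros x. apply Rabs_le. unfold n.
  generalize (pow2_ge_0 (u x + w x)) (pow2_ge_0 (v x + p x)) (pow2_ge_0 (u x - w x)) (pow2_ge_0 (v x - p x)).
  lra. }
assert (HF : forall x, X0 <= x -> n x / 2 <= F x <= 3 / 2 * n x).
{ intros x Hx. specialize (Hm x). specialize (Hax x Hx). unfold F. apply Rabs_le_between in Hm. nra. }
assert (Hn0 : forall x, 0 <= n x) by (intros x; unfold n; nra).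
assert (HdF : forall x, X0 <= x -> is_derive F x
  (2 * g x * (p x * u x + w x * v x) - 4 / (a * x ^ 2) * (u x * w x - v x * p x))).
{ intros x Hx. specialize (Hu x Hx). specialize (Hv x Hx). specialize (Hp x Hx). specialize (Hw x Hx).
  unfold F, n. auto_derive.
  - repeat split; try (eexists; eassumption). nra.
  - change (Derive (fun x => u x) x) with (Derive u x). change (Derive (fun x => v x) x) with (Derive v x).
    change (Derive (fun x => p x) x) with (Derive p x). change (Derive (fun x => w x) x) with (Derive w x).
    rewrite (is_derive_unique _ _ _ Hu), (is_derive_unique _ _ _ Hv),
      (is_derive_unique _ _ _ Hp), (is_derive_unique _ _ _ Hw).
    field. nra. }
intros x Hx.
assert (Hgr : F x * exp (K / x) <= F X0 * exp (K / X0)).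
{ eapply gronwall_inv_square; [lra | intros z Hz; apply HdF; lra |].
  intros z Hz. cbv beta. assert (HX1 : X0 <= z) by lra.
  specialize (Hg z HX1). specialize (Hm z). destruct (HF z HX1) as [HF1 _].
  assert (Hz2 : 0 < / z ^ 2) by (apply Rinv_0_lt_compat; nra).
  assert (Hi : Rabs (p z * u z + w z * v z) <= n z / 2).
  { apply Rabs_le. unfold n.
    generalize (pow2_ge_0 (u z + p z)) (pow2_ge_0 (v z + w z)) (pow2_ge_0 (u z - p z)) (pow2_ge_0 (v z - w z)).
    lra. }
  assert (HG : 0 <= G). { assert (0 <= G / z ^ 2) by (eapply Rle_trans; [apply Rabs_pos | exact Hg]).
    unfold Rdiv in *. nra. }
  assert (H1 : 2 * g z * (p z * u z + w z * v z) <= G / z ^ 2 * n z).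
  { eapply Rle_trans; [apply Rle_abs |]. rewrite Rmult_assoc, Rabs_mult, (Rabs_right 2) by lra.
    rewrite Rabs_mult. replace (G / z ^ 2 * n z) with (2 * ((G / z ^ 2) * (n z / 2))) by (field; nra).
    apply Rmult_le_compat_l; [lra |].
    apply Rmult_le_compat; auto using Rabs_pos. }
  assert (H2 : - (4 / (a * z ^ 2) * (u z * w z - v z * p z)) <= 2 / a / z ^ 2 * n z).
  { rewrite Ropp_mult_distr_r. replace (2 / a / z ^ 2 * n z) with (4 / (a * z ^ 2) * (n z / 2)) by (field; nra).
    apply Rmult_le_compat_l.
    - apply Rlt_le, Rdiv_lt_0_compat; [lra | apply Rmult_lt_0_compat; [lra | apply pow_lt; lra]].
    - apply Rabs_le_between in Hm. lra. }
  replace (K / z ^ 2 * F z) with ((G / z ^ 2 + 2 / a / z ^ 2) * (2 * F z)) by (unfold K; field; nra).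
  apply Rle_trans with ((G / z ^ 2 + 2 / a / z ^ 2) * n z); [lra |].
  apply Rmult_le_compat_l; [| lra].
  apply Rplus_le_le_0_compat; unfold Rdiv; apply Rmult_le_pos; try lra.
  apply Rmult_le_pos; [lra | apply Rlt_le, Rinv_0_lt_compat; lra]. }
assert (HK : 0 <= K).
{ assert (0 <= G / X0 ^ 2) by (eapply Rle_trans; [apply Rabs_pos | apply (Hg X0); lra]).
  assert (0 < / X0 ^ 2) by (apply Rinv_0_lt_compat; nra).
  assert (0 < 4 / a) by (apply Rdiv_lt_0_compat; lra).
  unfold K, Rdiv in *. nra. }
assert (1 <= exp (K / x)).
{ rewrite <- exp_0 at 1. apply exp_mono. apply Rdiv_le_0_compat; lra. }
destruct (HF x Hx) as [H1 _]. destruct (HF X0 (Rle_refl _)) as [_ H2].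
assert (0 < exp (K / X0)) by apply exp_pos.
specialize (Hn0 x). fold (n x) (n X0). fold K.
assert (F x <= F x * exp (K / x)) by nra.
assert (F X0 * exp (K / X0) <= 3 / 2 * n X0 * exp (K / X0)) by (apply Rmult_le_compat_r; lra).
lra.
Qed.

(** * The rescaled profile *)

(** The choice of the exponent [b], half of the coefficient [2 b = d - 1] of the
    radial drift, removes the term [R'/x] from the equation of [R = x^b Q], and
    since it is also [1/sigma] the term [i a b R] disappears too. *)
Lemma rescaled_system (a b V x : R) (q q1 : R -> C) : 0 < x ->
  cderive q x (q1 x) ->
  cderive q1 x ((1 - Ci * RtoC (a * b) - RtoC V) * q x
                - (RtoC (2 * b / x) + Ci * RtoC (a * x)) * q1 x)%C ->
  let u := (fun y => RtoC (powp b y) * q y)%C in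
  let v := (fun y => RtoC (powp b y) * (q1 y + RtoC (b / y) * q y))%C in
  cderive u x (v x) /\
  cderive v x (RtoC (1 + ((b * b - b) / x ^ 2 - V)) * u x - Ci * RtoC (a * x) * v x)%C.
Proof.
intros Hx Hq Hq1 u v.
assert (Hx1 : RtoC x <> RtoC 0) by (intros E; apply RtoC_inj in E; lra).
assert (Hp : cderive (fun y => RtoC (powp b y)) x (RtoC (b / x * powp b x))).
{ now apply is_derive_RtoC, is_derive_powp. }
split.
- replace (v x) with (RtoC (b / x * powp b x) * q x + RtoC (powp b x) * q1 x)%C.
  + now apply (is_derive_Cmult (fun y => RtoC (powp b y)) q).
  + unfold v. rewrite RtoC_mult. ring.
- assert (Hi : cderive (fun y => q1 y + RtoC (b / y) * q y)%C x
    (((1 - Ci * RtoC (a * b) - RtoC V) * q x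
                - (RtoC (2 * b / x) + Ci * RtoC (a * x)) * q1 x) +
     (RtoC (- b / x ^ 2) * q x + RtoC (b / x) * q1 x))%C).
  { apply (is_derive_plus (V := C_R_NormedModule) q1); [exact Hq1 |].
    apply (is_derive_Cmult (fun y => RtoC (b / y)) q); [| exact Hq].
    apply is_derive_RtoC. auto_derive; [lra |]. field; lra. }
  generalize (is_derive_Cmult (fun y => RtoC (powp b y)) _ x _ _ Hp Hi).
  match goal with |- cderive _ _ ?A -> cderive _ _ ?B => replace B with A; [easy |] end.
  unfold u, v.
  replace (2 * b) with (b + b) by ring. unfold Rdiv, Rminus.
  assert (x ^ 2 <> 0) by (apply pow_nonzero; lra).
  repeat first [rewrite RtoC_plus | rewrite RtoC_mult | rewrite RtoC_opp
    | rewrite RtoC_pow | rewrite RtoC_inv by lra].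
  field. easy.
Qed.

Lemma rescaled_bound (a b X0 : R) (q q1 : R -> C) (V : R -> R) :
  0 < a -> 0 <= b -> 1 <= X0 -> 4 / a <= X0 ->
  (forall x, X0 <= x -> cderive q x (q1 x)) ->
  (forall x, X0 <= x ->
    cderive q1 x ((1 - Ci * RtoC (a * b) - RtoC (V x)) * q x
                  - (RtoC (2 * b / x) + Ci * RtoC (a * x)) * q1 x)%C) ->
  (forall x, X0 <= x -> 0 <= V x <= / x ^ 2) ->
  forall x, X0 <= x ->
  (powp b x * Cmod (q x)) ^ 2 <=
  3 * exp ((2 * (Rabs (b * b - b) + 1) + 4 / a) / X0) * powp b X0 ^ 2 *
  (Cmod (q X0) ^ 2 + (Cmod (q1 X0) + b * Cmod (q X0)) ^ 2).
Proof.
intros Ha Hb HX1 HX Hq Hq1 HV x Hx.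
set (u := fun y => (RtoC (powp b y) * q y)%C).
set (v := fun y => (RtoC (powp b y) * (q1 y + RtoC (b / y) * q y))%C).
assert (Hs : forall y, X0 <= y -> cderive u y (v y) /\
  cderive v y (RtoC (1 + ((b * b - b) / y ^ 2 - V y)) * u y - Ci * RtoC (a * y) * v y)%C).
{ intros y Hy. apply rescaled_system; [lra | now apply Hq | now apply Hq1]. }
assert (Hs1 := fun y Hy => proj1 (is_derive_C_comp _ _ _) (proj1 (Hs y Hy))).
assert (Hs2 := fun y Hy => proj1 (is_derive_C_comp _ _ _) (proj2 (Hs y Hy))).
assert (HE := oscillator_energy_bound a (Rabs (b * b - b) + 1) X0
  (fun y => Re (u y)) (fun y => Im (u y)) (fun y => Re (v y)) (fun y => Im (v y))
  (fun y => (b * b - b) / y ^ 2 - V y) Ha ltac:(lra) HX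
  (fun y Hy => proj1 (Hs1 y Hy)) (fun y Hy => proj2 (Hs1 y Hy))).
assert (Hu2 : forall y, X0 <= y -> Re (u y) ^ 2 + Im (u y) ^ 2 = (powp b y * Cmod (q y)) ^ 2).
{ intros y Hy. rewrite <- Cmod2_alt. unfold u. 
  now rewrite Cmod_mult, Cmod_R, Rabs_right by (apply Rle_ge, powp_ge0). }
rewrite <- Hu2 by easy.
eapply Rle_trans; [| eapply Rle_trans; [apply HE; [| | | exact Hx] |]].
- generalize (pow2_ge_0 (Re (v x))) (pow2_ge_0 (Im (v x))). lra.
- intros y Hy. generalize (proj1 (Hs2 y Hy)).
  match goal with |- is_derive _ _ ?A -> is_derive _ _ ?B => replace B with A; [easy |] end.
  cbn -[pow]. ring.
- intros y Hy. generalize (proj2 (Hs2 y Hy)).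
  match goal with |- is_derive _ _ ?A -> is_derive _ _ ?B => replace B with A; [easy |] end.
  cbn -[pow]. ring.
- intros y Hy. destruct (HV y Hy) as [V1 V2]. 
  assert (0 < / y ^ 2) by (apply Rinv_0_lt_compat, pow_lt; lra).
  unfold Rdiv. generalize (Rabs_le_between (b * b - b) (Rabs (b * b - b))). intros [Hab _].
  specialize (Hab (Rle_refl _)). apply Rabs_le. nra.
- rewrite Rmult_assoc with (r2 := powp b X0 ^ 2). apply Rmult_le_compat_l.
  { generalize (exp_pos ((2 * (Rabs (b * b - b) + 1) + 4 / a) / X0)). lra. }
  rewrite Hu2 by apply Rle_refl. rewrite Rplus_assoc, <- Cmod2_alt.
  rewrite Rpow_mult_distr, Rmult_plus_distr_l. apply Rplus_le_compat_l.
  unfold v. rewrite Cmod_mult, Cmod_R, Rabs_right by (apply Rle_ge, powp_ge0).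
  rewrite Rpow_mult_distr. apply Rmult_le_compat_l; [apply pow2_ge_0 |].
  apply pow_incr. split; [apply Cmod_ge_0 |].
  eapply Rle_trans; [apply Cmod_triangle |]. apply Rplus_le_compat_l.
  rewrite Cmod_mult. apply Rmult_le_compat_r; [apply Cmod_ge_0 |].
  rewrite Cmod_R, Rabs_right by (apply Rle_ge, Rdiv_le_0_compat; lra).
  unfold Rdiv. rewrite <- (Rmult_1_r b) at 2. apply Rmult_le_compat_l; [easy |].
  rewrite <- Rinv_1. apply Rinv_le_contravar; lra.
Qed.

Lemma Rpower_neg_lim (b : R) : 0 < b ->
  forall e, 0 < e -> exists M, forall x, M < x -> Rpower x (- b) < e.
Proof.
intros Hb e He. exists (Rmax 0 (Rpower e (- / b))). intros x Hx.
assert (0 < x) by (eapply Rle_lt_trans; [apply Rmax_l | exact Hx]).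
assert (Hx1 : Rpower e (- / b) < x) by (eapply Rle_lt_trans; [apply Rmax_r | exact Hx]).
replace e with (Rpower (Rpower e (- / b)) (- b)).
2: { rewrite Rpower_mult. replace (- / b * - b) with 1 by (field; lra). now apply Rpower_1. }
rewrite !(Rpower_Ropp _ b). apply Rinv_lt_contravar.
- apply Rmult_lt_0_compat; apply exp_pos.
- apply Rlt_Rpower_l; [lra |]. split; [apply exp_pos | easy].
Qed.

(** The exponential bound of [damped_ivp] controls the solution up to [X0] and
    the energy estimate controls it beyond. Both bounds are proportional to
    [eps], with constants that depend only on [a], [b] and [p]; a small [eps]
    keeps the solution below the truncation level everywhere. *)
Lemma truncated_profile (a b p : R) : 0 < a -> 1 / 2 <= b -> 1 <= p -> p * b = 2 ->
  exists q : R -> C,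
   let f := fun s => ((1 - Ci * RtoC (a * b) - RtoC (potential p (cutoff b s) (q s))) * q s)%C in
   (forall s, ccont q s) /\ (forall s, ccont f s) /\
   (exists eps, 0 < eps /\ forall s, q s = (RtoC eps + CInt (damp (2 * b) a f) 0 s)%C) /\
   (forall s, 0 <= s -> Cmod (q s) <= cutoff b s).
Proof.
intros Ha Hb Hp Hpb.
set (kap := (1 - Ci * RtoC (a * b))%C).
set (N := fun s q => ((kap - RtoC (potential p (cutoff b s) q)) * q)%C).
set (L := Cmod kap + 1 + p).
set (X0 := Rmax 1 (4 / a)).
set (E := exp (2 * L * X0)).
set (W := powp b X0).
set (M := 3 * exp ((2 * (Rabs (b * b - b) + 1) + 4 / a) / X0) * W ^ 2 * (E ^ 2 * (4 + (1 + 2 * b) ^ 2))).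
(* [M eps^2] bounds both [(X0^b |Q|)^2] up to [X0] and [|R|^2] beyond it. *)
set (eps := / (1 + M)).
assert (Hkap : 0 <= Cmod kap) by apply Cmod_ge_0.
assert (HX1 : 1 <= X0) by apply Rmax_l.
assert (HX : 4 / a <= X0) by apply Rmax_r.
assert (HE : 0 < E) by apply exp_pos.
assert (HW : 0 < W) by (apply powp_gt0; lra).
assert (HWE : 0 < W ^ 2 * E ^ 2) by (apply Rmult_lt_0_compat; apply pow_lt; lra).
assert (HM : 4 * (W ^ 2 * E ^ 2) <= M).
{ unfold M. assert (0 <= (2 * (Rabs (b * b - b) + 1) + 4 / a) / X0).
  { apply Rdiv_le_0_compat; [| lra]. assert (0 < 4 / a) by (apply Rdiv_lt_0_compat; lra).
    generalize (Rabs_pos (b * b - b)). lra. }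
  assert (1 <= exp ((2 * (Rabs (b * b - b) + 1) + 4 / a) / X0)).
  { rewrite <- exp_0 at 1. now apply exp_mono. }
  generalize (pow2_ge_0 (1 + 2 * b)). intros.
  replace (4 * (W ^ 2 * E ^ 2)) with (1 * (W ^ 2 * E ^ 2) * 4) by ring.
  rewrite !Rmult_assoc. rewrite <- (Rmult_assoc 3).
  rewrite <- (Rmult_assoc (W ^ 2)), <- (Rmult_assoc (W ^ 2)).
  apply Rmult_le_compat; nra. }
assert (Heps : 0 < eps) by (apply Rinv_0_lt_compat; nra).
assert (HMe : M * eps ^ 2 <= 1).
{ assert (H1 : (1 + M) * eps = 1) by (unfold eps; apply Rinv_r; nra). nra. }
assert (HL : 1 <= L) by (unfold L; lra).
assert (Hcut : forall s, 0 <= cutoff b s <= 1).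
{ intros s; split; [apply Rlt_le, cutoff_gt0 | apply cutoff_le1; lra]. }
assert (HNc : forall q, (forall s, ccont q s) -> forall s, ccont (fun s => N s (q s)) s).
{ intros q Hq s. unfold N. apply continuous_Cmult; [| apply Hq].
  apply (continuous_minus (V := C_R_NormedModule) (fun _ => kap)); [apply continuous_const |].
  apply continuous_RtoC, continuous_potential; [easy | apply continuous_cutoff | apply Hq]. }
destruct (damped_ivp (2 * b) a eps L N) as [q [Hqc [Hq Hqb]]]; [lra | lra | lra | | | |].
- intros s. unfold N. ring.
- intros s r t. unfold N.
  replace ((kap - RtoC (potential p (cutoff b s) r)) * r - (kap - RtoC (potential p (cutoff b s) t)) * t)%C with
   (kap * (r - t) + - (RtoC (potential p (cutoff b s) r) * r - RtoC (potential p (cutoff b s) t) * t))%C by ring.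
  eapply Rle_trans; [apply Cmod_triangle |]. rewrite Cmod_opp, Cmod_mult.
  generalize (potential_lipschitz p (cutoff b s) r t Hp (Hcut s)). unfold L. lra.
- exact HNc.
- exists q. set (f := fun s => N s (q s)).
  assert (Hf : forall s, ccont f s) by (intros s; now apply HNc).
  split; [easy |]. split; [exact Hf |]. split; [now exists eps |].
  intros s Hs.
  destruct (Rle_or_lt s X0) as [HsX | HsX].
  + apply Rle_trans with (/ W).
    * eapply Rle_trans; [apply Hqb, Hs |].
      assert (exp (2 * L * s) <= E) by (apply exp_mono; nra).
      apply Rmult_le_reg_l with W; [easy |]. rewrite Rinv_r by lra.
      assert (W * (2 * eps * E) <= 1).
      { apply Rsqr_incr_0_var; [| lra]. rewrite Rsqr_1. unfold Rsqr. nra. }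
      apply Rle_trans with (W * (2 * eps * E)); [| easy].
      apply Rmult_le_compat_l; [lra |]. apply Rmult_le_compat_l; lra.
    * apply Rle_trans with (cutoff b X0); [| apply cutoff_le; lra].
      unfold cutoff, W. rewrite Rmax_right by easy. rewrite powp_pos, Rpower_Ropp by lra. lra.
  + assert (HX0q : Cmod (q X0) <= 2 * eps * E) by (apply Hqb; lra).
    assert (HX0d : Cmod (damp (2 * b) a f X0) <= eps * E).
    { replace (eps * E) with (L * (2 * eps) / (2 * L) * E) by (field; lra).
      apply Cmod_damp_le_exp; [lra | lra | nra | lra | easy |].
      intros t Ht. unfold f, N. rewrite Cmod_mult, Rmult_assoc.
      apply Rmult_le_compat; try apply Cmod_ge_0; [| apply Hqb; lra].
      unfold Cminus. eapply Rle_trans; [apply Cmod_triangle |].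
      rewrite Cmod_opp, Cmod_R, Rabs_right by (apply Rle_ge, potential_ge0).
      assert (potential p (cutoff b t) (q t) <= 1).
      { eapply Rle_trans; [apply potential_le; lra | apply powp_le1; [lra | apply Hcut]]. }
      unfold L. lra. }
    assert (HB := rescaled_bound a b X0 q (damp (2 * b) a f)
      (fun x => potential p (cutoff b x) (q x)) Ha ltac:(lra) HX1 HX).
    assert (Hsq : (powp b s * Cmod (q s)) ^ 2 <= 1).
    { eapply Rle_trans; [apply HB; [| | | lra] |].
      - intros x Hx. apply (is_derive_CInt_damp _ a eps f); [lra | easy | exact Hq].
      - intros x Hx. apply (is_derive_damp (2 * b) a f); [lra | lra | easy].
      - intros x Hx. split; [apply potential_ge0 |].
        rewrite <- (powp_cutoff b p) by lra. apply potential_le; lra.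
      - apply Rle_trans with (M * eps ^ 2); [| easy]. unfold M. 
        replace (3 * exp ((2 * (Rabs (b * b - b) + 1) + 4 / a) / X0) * W ^ 2 *
          (E ^ 2 * (4 + (1 + 2 * b) ^ 2)) * eps ^ 2) with 
         (3 * exp ((2 * (Rabs (b * b - b) + 1) + 4 / a) / X0) * W ^ 2 *
          ((2 * eps * E) ^ 2 + (eps * E + b * (2 * eps * E)) ^ 2)) by ring.
        apply Rmult_le_compat_l.
        { apply Rmult_le_pos; [| apply pow2_ge_0].
          generalize (exp_pos ((2 * (Rabs (b * b - b) + 1) + 4 / a) / X0)). lra. }
        apply Rplus_le_compat; apply pow_incr.
        + split; [apply Cmod_ge_0 | easy].
        + split.
          * apply Rplus_le_le_0_compat; [apply Cmod_ge_0 |].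
            apply Rmult_le_pos; [lra | apply Cmod_ge_0].
          * apply Rplus_le_compat; [easy |]. apply Rmult_le_compat_l; lra. }
    assert (Hs1 : powp b s * Cmod (q s) <= 1).
    { apply Rsqr_incr_0_var; [| lra]. rewrite Rsqr_1, Rsqr_pow2. exact Hsq. }
    unfold cutoff. rewrite Rmax_right, Rpower_Ropp by lra. rewrite <- powp_pos by lra.
    assert (0 < powp b s) by (apply powp_gt0; lra).
    apply Rmult_le_reg_l with (powp b s); [easy |]. rewrite Rinv_r; lra.
Qed.

Theorem theorem2p2 :
  forall (d sigma : R), 2 <= d -> 1 / 2 < sigma ->
  d / 2 - 1 / sigma = 1 / 2 ->
  forall (a : R), 0 < a ->
  exists Q : R -> C,
    global_profile d sigma a Q /\
    (exists xi : R, 0 <= xi /\ Q xi <> RtoC 0) /\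
    (exists B : R -> C,
       (exists M : R, forall xi : R, 0 < xi -> Cmod (B xi) <= M) /\
       (forall xi : R, 0 < xi ->
          Q xi = (RtoC (Rpower xi (- (1 / sigma))) * B xi)%C)).
Proof.
intros d sigma Hd Hsig Hcrit a Ha.
set (b := 1 / sigma) in *.
assert (Hbs : sigma * b = 1) by (unfold b; field; lra).
destruct (truncated_profile a b (2 * sigma)) as [q [Hqc [Hf [[eps [Heps Hq]] Hcut]]]]; [lra | lra | lra | lra |].
cbv zeta in Hf, Hq.
set (f := fun s => ((1 - Ci * RtoC (a * b) - RtoC (potential (2 * sigma) (cutoff b s) (q s))) * q s)%C) in *.
assert (Hq0 : q 0 = RtoC eps).
{ rewrite Hq. rewrite CInt_zero; [ring |]. intros s. rewrite Rmin_left, Rmax_left by lra. lra. }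
assert (Hbound : forall s, 0 < s -> Cmod (q s) <= Rpower s (- b)).
{ intros s Hs. eapply Rle_trans; [apply Hcut; lra |]. unfold cutoff.
  rewrite !Rpower_Ropp. apply Rinv_le_contravar; [apply exp_pos |].
  apply Rle_Rpower_l; [lra |]. split; [easy | apply Rmax_r]. }
exists q. split; [| split].
- exists (damp (2 * b) a f), (damp_deriv (2 * b) a f). split; [| split; [| split; [| split]]].
  + apply (damp_is_C2 (2 * b) a eps); [lra | easy | exact Hq].
  + intros x Hx. unfold profile_equation_at, radial_laplacian, damp_deriv.
    destruct (Rle_dec x 0) as [H | _]; [lra |].
    unfold f at 1. unfold potential. rewrite Rmin_left by (apply Hcut; lra).
    rewrite powp_nnpow by apply Cmod_ge_0.
    replace (d - 1) with (2 * b) by lra.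
    replace (q x / RtoC sigma)%C with (RtoC b * q x)%C.
    * rewrite !RtoC_mult. ring.
    * unfold b. rewrite RtoC_div by lra. field. intros E; apply RtoC_inj in E; lra.
  + apply damp_nonpos; lra.
  + rewrite Hq0. reflexivity.
  + apply filterlim_Cmod; [apply Rbar_locally_filter |]. intros e He.
    destruct (Rpower_neg_lim b ltac:(lra) e He) as [M HM].
    exists (Rmax 0 M). intros x Hx.
    assert (0 < x) by (eapply Rle_lt_trans; [apply Rmax_l | exact Hx]).
    replace (q x - 0)%C with (q x) by ring.
    eapply Rle_lt_trans; [now apply Hbound |]. apply HM.
    eapply Rle_lt_trans; [apply Rmax_r | exact Hx].
- exists 0. split; [lra |]. rewrite Hq0. intros E. apply RtoC_inj in E. lra.
- exists (fun s => RtoC (Rpower s b) * q s)%C. split.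
  + exists 1. intros s Hs. rewrite Cmod_mult, Cmod_R, Rabs_right by (apply Rle_ge, Rlt_le, exp_pos).
    apply Rle_trans with (Rpower s b * Rpower s (- b)).
    * apply Rmult_le_compat_l; [apply Rlt_le, exp_pos | now apply Hbound].
    * rewrite <- Rpower_plus, Rplus_opp_r, Rpower_O by easy. lra.
  + intros s Hs. rewrite Cmult_assoc, <- RtoC_mult, <- Rpower_plus, Rplus_opp_l, Rpower_O by easy. ring.
Qed.
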